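(* Let $\gamma=\gamma(z)$ be a function with $\gamma(1)\neq 0$, and let $f\in\mathcal{F}_1$. 1. Let $g=g(z)$ satisfy $g=1+z\gamma(g)$. Then $(g,f)$ and $[g,f]$ are pseudo-involutions if and only if $$f=\frac{z}{\gamma(1-z)}\circ\frac{z}{1+z}\circ\widehat{\frac{z}{\gamma(1-z)}},$$ or, equivalently, if and only if $f=h\circ\widehat{h}$ for $$h=\frac{z}{\gamma(1-z)}\circ\frac{2z}{2+z}=\frac{2z}{(2+z)\,\gamma\!\left(\frac{2-z}{2+z}\right)}=2z\circ\frac{z}{(1+z)\,\gamma\!\left(\frac{1-z}{1+z}\right)}\circ\frac{z}{2}.$$ 2. Let $g=g(z)$ satisfy $g=e^{z\gamma(g)}$. Then $(g,f)$ and $[g,f]$ are pseudo-involutions if and only if $$f=\frac{z}{\gamma(e^{-z})}\circ\widehat{\frac{z}{\gamma(e^{-z})}},$$ or, equivalently, if and only if $f=h\circ\widehat{h}$ for $$h=\frac{z}{\gamma(e^{-z})}.$$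
   Context: $\mathcal{F}_k$ denotes the set of formal power series in $\mathbb{R}[[z]]$ of order exactly $k$. For $f\in\mathcal{F}_1$, $\overline f$ is its compositional inverse and $\widehat{f}=(-z)\circ\overline{f}\circ(-z)$ is its pseudo-inverse. For $g\in\mathcal{F}_0,\ f\in\mathcal{F}_1$, the Riordan array $(g,f)$ is the infinite lower triangular matrix $[d_{n,k}]_{n,k\ge0}$ with $\sum_{n}d_{n,k}z^n=g f^k$; the exponential Riordan array $[g,f]$ is the matrix with $\sum_{n}d_{n,k}\frac{z^n}{n!}=\frac{g f^k}{k!}$. In both cases matrix multiplication corresponds to $(g,f)(G,F)=(g\cdot(G\circ f),F\circ f)$ (and likewise for $[\cdot,\cdot]$). The array $(g,f)$ (resp. $[g,f]$) is a pseudo-involution if $(g,-f)$ (resp. $[g,-f]$) squares to the identity; equivalently $g\circ(-f)=1/g$ and $\widehat f=f$. The function $\gamma$ is understood through its power series expansion at $z=1$, i.e. $\gamma(1+w)\in\mathbb{R}[[w]]$ with nonzero constant term $\gamma(1)$, so that for any power series $a(z)$ with $a(0)=1$ the composition $\gamma(a(z))$ is a formal power series; $g$ is a formal power series with $g(0)=1$. *)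

(* Defs.v *)
(* MathComp, with the classical axioms of MathComp-Analysis for the decidable
   equality and the choice operator on power series. *)
From HB Require Import structures.
From mathcomp Require Import all_boot all_order all_algebra.
From mathcomp Require Import boolp classical_sets reals.

Set Implicit Arguments.
Unset Strict Implicit.
Unset Printing Implicit Defensive.

Import GRing.Theory.
Local Open Scope ring_scope.

Reserved Notation "{ 'fps' R }" (format "{ 'fps'  R }").
Reserved Notation "a \oS b" (at level 50, left associativity).

(* [f n] is the coefficient of z^n; in particular [f 0%N] is f(0). *)
Record fps (R : Type) := Fps { coefs :> nat -> R }.
Notation "{ 'fps' R }" := (fps R) : type_scope.

HB.instance Definition _ (R : Type) := gen_eqMixin {fps R}.
HB.instance Definition _ (R : Type) := gen_choiceMixin {fps R}.

Lemma fpsP (R : Type) (a b : {fps R}) : (forall n, a n = b n) -> a = b.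
Proof. by case: a b => [a] [b] /= /funext ->. Qed.

(* The solution g of the lower triangular system
   \sum_(k <= n) g k * T n k = d n, for T with nonzero diagonal. *)
Section TriangularSystems.
Variables (R : fieldType) (T : nat -> nat -> R) (d : nat -> R).

Fixpoint tri_seq (n : nat) : seq R :=
  if n is m.+1 then
    let s := tri_seq m in
    rcons s ((d m - \sum_(k < m) s`_k * T m k) / T m m)
  else [::].

Definition tri_solve (n : nat) : R := (tri_seq n.+1)`_n.

Lemma size_tri_seq n : size (tri_seq n) = n.
Proof. by elim: n => //= n IH; rewrite size_rcons IH. Qed.

Lemma nth_tri_seq n k : (k < n)%N -> (tri_seq n)`_k = tri_solve k.
Proof.
elim: n => // n IH; rewrite ltnS leq_eqVlt => /orP[/eqP-> //|kn].
by rewrite /= nth_rcons size_tri_seq kn IH.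
Qed.

Lemma tri_solveP n : T n n != 0 -> \sum_(k < n.+1) tri_solve k * T n k = d n.
Proof.
move=> Tn0; rewrite big_ord_recr /= {2}/tri_solve /= nth_rcons size_tri_seq.
rewrite ltnn eqxx divfK //.
under [X in _ + (_ - X)]eq_bigr => k _ do rewrite nth_tri_seq //.
by rewrite addrC subrK.
Qed.

End TriangularSystems.

Section FpsRing.
Variable R : fieldType.
Implicit Types a b c : {fps R}.

Definition fps_zero : {fps R} := Fps (fun=> 0).
Definition fps_opp a : {fps R} := Fps (fun n => - a n).
Definition fps_add a b : {fps R} := Fps (fun n => a n + b n).
Definition fps_one : {fps R} := Fps (fun n => (n == 0%N)%:R).
Definition fps_mul a b : {fps R} :=
  Fps (fun n => \sum_(i < n.+1) a i * b (n - i)%N).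

Fact fps_addA : associative fps_add.
Proof. by move=> a b c; apply: fpsP => n /=; rewrite addrA. Qed.
Fact fps_addC : commutative fps_add.
Proof. by move=> a b; apply: fpsP => n /=; rewrite addrC. Qed.
Fact fps_add0 : left_id fps_zero fps_add.
Proof. by move=> a; apply: fpsP => n /=; rewrite add0r. Qed.
Fact fps_addN : left_inverse fps_zero fps_opp fps_add.
Proof. by move=> a; apply: fpsP => n /=; rewrite addNr. Qed.

HB.instance Definition _ :=
  GRing.isZmodule.Build {fps R} fps_addA fps_addC fps_add0 fps_addN.

Definition fps_trunc (N : nat) a : {poly R} := \poly_(i < N.+1) a i.

Fact coef_fps_trunc N a n : (n <= N)%N -> (fps_trunc N a)`_n = a n.
Proof. by move=> nN; rewrite coef_poly ltnS nN. Qed.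

Fact fps_mul_trunc N a b n : (n <= N)%N ->
  fps_mul a b n = (fps_trunc N a * fps_trunc N b)`_n.
Proof.
move=> nN; rewrite coefM; apply: eq_bigr => i _.
by rewrite !coef_fps_trunc // (leq_trans _ nN) ?leq_subr // -ltnS.
Qed.

Fact fps_mulC : commutative fps_mul.
Proof.
by move=> a b; apply: fpsP => n; rewrite !(fps_mul_trunc _ _ (leqnn n)) mulrC.
Qed.

Fact fps_mulA : associative fps_mul.
Proof.
move=> a b c; apply: fpsP => n; transitivity
    ((fps_trunc n a * (fps_trunc n b * fps_trunc n c))`_n).
  rewrite coefM; apply: eq_bigr => i _.
  by rewrite coef_fps_trunc -1?ltnS // (@fps_mul_trunc n) // leq_subr.
rewrite mulrA coefM; apply: eq_bigr => i _.
by rewrite (@fps_mul_trunc n) -1?ltnS // coef_fps_trunc // leq_subr.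
Qed.

Fact fps_mul1 : left_id fps_one fps_mul.
Proof.
move=> a; apply: fpsP => n /=; rewrite big_ord_recl /= mul1r subn0.
by rewrite big1 ?addr0 // => i _; rewrite /bump /= mul0r.
Qed.

Fact fps_mulDl : left_distributive fps_mul fps_add.
Proof.
move=> a b c; apply: fpsP => n /=; rewrite -big_split /=.
by apply: eq_bigr => i _; rewrite mulrDl.
Qed.

Fact fps_one_neq0 : fps_one != fps_zero.
Proof.
apply/eqP => /(congr1 (fun a : {fps R} => a 0%N)) /= /eqP.
by rewrite oner_eq0.
Qed.

HB.instance Definition _ := GRing.Zmodule_isComNzRing.Build {fps R}
  fps_mulA fps_mulC fps_mul1 fps_mulDl fps_one_neq0.

Definition fps_unit : pred {fps R} := [pred a : {fps R} | a 0%N != 0].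
Definition fps_inv a : {fps R} :=
  if a 0%N != 0 then
    Fps (tri_solve (fun n k => a (n - k)%N) (fun n => (n == 0%N)%:R))
  else a.

Fact fps_mulVx : {in fps_unit, left_inverse 1 fps_inv *%R}.
Proof.
move=> a; rewrite /fps_inv -topredE /= /fps_unit /= => a0; rewrite a0.
by apply: fpsP => n; apply: tri_solveP; rewrite subnn.
Qed.

Fact fps_unitP a b : b * a = 1 -> fps_unit a.
Proof.
move=> /(congr1 (fun a : {fps R} => a 0%N)) /=.
rewrite big_ord_recl big_ord0 addr0 /= => ba1; apply/eqP => a0.
by move/eqP: ba1; rewrite a0 mulr0 eq_sym oner_eq0.
Qed.

Fact fps_inv_out : {in [predC fps_unit], fps_inv =1 id}.
Proof. by move=> a; rewrite inE /fps_inv -topredE /= /fps_unit /= => /negPf ->. Qed.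

HB.instance Definition _ := GRing.ComNzRing_hasMulInverse.Build {fps R}
  fps_mulVx fps_unitP fps_inv_out.

Lemma fps_coef0 n : (0 : {fps R}) n = 0. Proof. by []. Qed.
Lemma fps_coef1 n : (1 : {fps R}) n = (n == 0%N)%:R. Proof. by []. Qed.
Lemma fps_coefD a b n : (a + b) n = a n + b n. Proof. by []. Qed.
Lemma fps_coefN a n : (- a) n = - a n. Proof. by []. Qed.
Lemma fps_coefM a b n : (a * b) n = \sum_(i < n.+1) a i * b (n - i)%N.
Proof. by []. Qed.
Lemma fps_unitE a : (a \is a GRing.unit) = (a 0%N != 0). Proof. by []. Qed.

End FpsRing.

Section Composition.
Variable R : fieldType.
Implicit Types a b c f g h : {fps R}.

(* The set F_k of the series of order exactly k. *)
Definition fps_order (k : nat) : set {fps R} :=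
  [set f : {fps R} | (forall i, (i < k)%N -> f i = 0) /\ f k != 0].

(* The formal variable z. *)
Definition fpsX : {fps R} := Fps (fun n => (n == 1%N)%:R).

(* a(b(z)) = \sum_k a_k b^k; only meaningful when b(0) = 0, in which case the
   terms with k > n do not contribute to the coefficient of z^n. *)
Definition fps_comp a b : {fps R} :=
  Fps (fun n => \sum_(k < n.+1) a k * (b ^+ k) n).

Local Notation "a \oS b" := (fps_comp a b) : ring_scope.

Definition fps_exp : {fps R} := Fps (fun n => (n`!%:R)^-1).

(* For a function gamma given by its expansion c(w) = gamma(1 + w) at 1, this
   is the series gamma(a(z)); only meaningful when a(0) = 1. *)
Definition fps_at1 c a : {fps R} := c \oS (a - 1).

(* For f of order 1, the unique h such that h o f = f o h = z (see
   fps_cinvP and fps_cinv_uniq). *)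
Definition fps_cinv f : {fps R} :=
  xget 0 [set h | h \oS f = fpsX /\ f \oS h = fpsX].

Definition fps_hat f : {fps R} := (- fpsX) \oS fps_cinv f \oS (- fpsX).

Lemma fps_exprn_small b k n : b 0%N = 0 -> (n < k)%N -> (b ^+ k) n = 0.
Proof.
move=> b0; elim: k n => // k IH n; rewrite ltnS => nk.
rewrite exprS fps_coefM big_ord_recl b0 mul0r add0r big1 // => i _.
rewrite IH ?mulr0 //= (leq_trans _ nk) // ltn_subrL /=.
exact: leq_ltn_trans (leq0n i) (ltn_ord i).
Qed.

Lemma fps_exprn_diag b n : b 0%N = 0 -> (b ^+ n) n = b 1%N ^+ n.
Proof.
move=> b0; elim: n => // n IH; rewrite exprS fps_coefM big_ord_recl b0 mul0r.
rewrite add0r big_ord_recl /= /bump /= subSS subn0 IH -exprS big1 ?addr0 //.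
move=> i _; rewrite fps_exprn_small ?mulr0 //= /bump /= add1n subSS ltn_subrL.
exact: leq_ltn_trans (leq0n i) (ltn_ord i).
Qed.

Lemma fps_comp_wide a b n N : b 0%N = 0 -> (n <= N)%N ->
  (a \oS b) n = \sum_(k < N.+1) a k * (b ^+ k) n.
Proof.
move=> b0 nN; rewrite -(subnKC nN) -addSn big_split_ord /=.
rewrite [X in _ + X]big1 ?addr0 // => i _.
by rewrite fps_exprn_small ?mulr0 //= addSn ltnS leq_addr.
Qed.

Lemma fps_compM a b c : c 0%N = 0 -> (a * b) \oS c = (a \oS c) * (b \oS c).
Proof.
move=> c0; apply: fpsP => n; rewrite fps_coefM /=.
pose F k l := a k * b l * (c ^+ (k + l)) n.
transitivity (\sum_(k < n.+1) \sum_(l < n.+1) F k l); last first.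
  transitivity (\sum_(i < n.+1) \sum_(k < n.+1) \sum_(l < n.+1)
      a k * b l * ((c ^+ k) i * (c ^+ l) (n - i)%N)).
    rewrite [RHS]exchange_big /=; apply: eq_bigr => k _.
    rewrite [RHS]exchange_big /=; apply: eq_bigr => l _.
    by rewrite /F exprD fps_coefM mulr_sumr.
  apply: eq_bigr => i _.
  rewrite -[RHS]/((a \oS c) i * (b \oS c) (n - i)%N).
  rewrite (fps_comp_wide a c0 (_ : (i <= n)%N)) -1?ltnS //.
  rewrite (fps_comp_wide b c0 (leq_subr i n)) mulr_suml.
  apply: eq_bigr => k _; rewrite mulr_sumr; apply: eq_bigr => l _.
  by rewrite mulrACA.
transitivity (\sum_(m < n.+1) \sum_(i < n.+1 | (i <= m)%N) F i (m - i)%N).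
  apply: eq_bigr => m _; rewrite mulr_suml.
  have mn : (m.+1 <= n.+1)%N by [].
  rewrite (big_ord_widen n.+1 (fun i => a i * b (m - i)%N * (c ^+ m) n) mn).
  by apply: eq_big => // i; rewrite ltnS => im; rewrite /F subnKC.
rewrite (exchange_big_dep predT) //=; apply: eq_bigr => i _.
rewrite -(big_mkord (fun m => i <= m)%N (fun m => F i (m - i)%N)).
rewrite -(big_mkord predT (F i)).
rewrite [LHS](@big_cat_nat _ _ _ i) //=; last by rewrite ltnW.
rewrite [X in X + _]big_nat_cond [X in X + _]big1 ?add0r; last first.
  by move=> m /andP[/andP[_ mi]]; rewrite leqNgt mi.
rewrite [RHS](@big_cat_nat _ _ _ (n.+1 - i)) ?leq_subr //=.
rewrite [X in _ = _ + X]big_nat_cond [X in _ = _ + X]big1 ?addr0; last first.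
  move=> l /andP[/andP[nl _] _]; rewrite /F fps_exprn_small ?mulr0 //.
  by rewrite -leq_subLR.
rewrite -{1}[i : nat]add0n big_addn.
by apply: eq_big => [l|l _]; rewrite ?leq_addl ?addnK.
Qed.

Lemma fps_comp1 c : 1 \oS c = 1.
Proof.
apply: fpsP => n /=; rewrite big_ord_recl /= mul1r big1 ?addr0 //.
by move=> i _; rewrite mul0r.
Qed.

Lemma fps_compXn a c k : c 0%N = 0 -> (a ^+ k) \oS c = (a \oS c) ^+ k.
Proof.
move=> c0; elim: k => [|k IH]; first by rewrite fps_comp1.
by rewrite !exprS fps_compM // IH.
Qed.

Lemma fps_comp0 a b : (a \oS b) 0%N = a 0%N.
Proof. by rewrite /= big_ord_recl big_ord0 addr0 expr0 mulr1. Qed.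

Lemma fps_compA a b c : b 0%N = 0 -> c 0%N = 0 ->
  a \oS (b \oS c) = a \oS b \oS c.
Proof.
move=> b0 c0; apply: fpsP => n /=.
transitivity (\sum_(k < n.+1) \sum_(j < n.+1) a k * ((b ^+ k) j * (c ^+ j) n)).
  by apply: eq_bigr => k _; rewrite -fps_compXn //= mulr_sumr.
rewrite exchange_big /=; apply: eq_bigr => j _.
rewrite -[X in _ = X * _]/((a \oS b) j).
rewrite (fps_comp_wide a b0 (_ : (j <= n)%N)) -1?ltnS //.
by rewrite mulr_suml; apply: eq_bigr => k _; rewrite mulrA.
Qed.

Lemma fps_compX a : a \oS fpsX = a.
Proof.
have XnE k n : (fpsX ^+ k) n = (n == k)%:R.
  elim: k n => // k IH n; rewrite exprS fps_coefM big_ord_recl mul0r add0r.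
  case: n => [|n]; first by rewrite big_ord0.
  rewrite big_ord_recl /= mul1r subSS subn0 IH eqSS big1 ?addr0 // => i _.
  by rewrite mul0r.
apply: fpsP => n /=; rewrite big_ord_recr /= XnE eqxx mulr1 big1 ?add0r //.
by move=> i _; rewrite XnE gtn_eqF ?mulr0.
Qed.

Lemma fps_Xcomp b : b 0%N = 0 -> fpsX \oS b = b.
Proof.
move=> b0; apply: fpsP => -[|n]; first by rewrite fps_comp0 b0.
rewrite /= !big_ord_recl /= mul0r add0r mul1r expr1 big1 ?addr0 // => i _.
by rewrite mul0r.
Qed.

Lemma fps_cinv_ex f : fps_order 1 f ->
  exists2 h, fps_order 1 h & h \oS f = fpsX.
Proof.
move=> [f0 f1]; have {}f0 := f0 0%N isT.
pose h := Fps (tri_solve (fun n k => (f ^+ k) n) (fun n => (n == 1%N)%:R)).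
have hf : h \oS f = fpsX.
  by apply: fpsP => n; apply: tri_solveP; rewrite fps_exprn_diag // expf_neq0.
exists h => //; have h0 : h 0%N = 0 by rewrite -(fps_comp0 h f) hf.
split=> [[]//|]; apply/eqP => h1.
have /eqP := congr1 (fun a : {fps R} => a 1%N) hf.
rewrite -[fpsX 1%N]/1 -[X in X == _]/(\sum_(k < 2) h k * (f ^+ k) 1%N).
by rewrite !big_ord_recl big_ord0 h0 [h (lift _ _)]h1 !mul0r !addr0 eq_sym oner_eq0.
Qed.

Lemma fps_cinvP f : fps_order 1 f ->
  fps_cinv f \oS f = fpsX /\ f \oS fps_cinv f = fpsX.
Proof.
move=> of1; have [h oh hf] := fps_cinv_ex of1.
have [k ok kh] := fps_cinv_ex oh.
have f0 := of1.1 0%N isT; have h0 := oh.1 0%N isT.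
have kf : k = f by rewrite -(fps_compX k) -hf fps_compA // kh fps_Xcomp.
apply: (xgetPex 0 (P := [set x | x \oS f = fpsX /\ f \oS x = fpsX])).
by exists h; split=> //; rewrite -kf.
Qed.

Lemma fps_cinv_uniq f h : fps_order 1 f -> h \oS f = fpsX -> h = fps_cinv f.
Proof.
move=> of1 hf; have [cf fc] := fps_cinvP of1.
have c0 : fps_cinv f 0%N = 0 by rewrite -(fps_comp0 _ f) cf.
by rewrite -(fps_compX h) -fc fps_compA ?hf ?fps_Xcomp //; apply: of1.1.
Qed.

End Composition.

Arguments fpsX {R}.
Arguments fps_exp {R}.
Notation "a \oS b" := (fps_comp a b) : ring_scope.

Section RiordanArrays.
Variable R : fieldType.
Implicit Types (g f : {fps R}) (A B : nat -> nat -> R).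

Definition riordan g f : nat -> nat -> R := fun n k => (g * f ^+ k) n.

Definition exp_riordan g f : nat -> nat -> R :=
  fun n k => n`!%:R * (k`!%:R)^-1 * (g * f ^+ k) n.

(* Product of infinite lower triangular matrices: A n j = 0 for j > n. *)
Definition ltmx_mul A B : nat -> nat -> R :=
  fun n k => \sum_(j < n.+1) A n j * B j k.

Definition ltmx_id : nat -> nat -> R := fun n k => (n == k)%:R.

Definition pseudo_involution g f : Prop :=
  ltmx_mul (riordan g (- f)) (riordan g (- f)) =2 ltmx_id.

Definition exp_pseudo_involution g f : Prop :=
  ltmx_mul (exp_riordan g (- f)) (exp_riordan g (- f)) =2 ltmx_id.

End RiordanArrays.

(* Main.v *)
(* Write g = E o v with E = 1 + z (part 1) or E = e^z (part 2), so that
   v = z gamma(E(v)), and put k = z / gamma(E(-z)).  Then k(-v) = -z, that is,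
   v is the pseudo-inverse of k.  If sigma satisfies E(-sigma) = 1/E, the
   condition g(-f) = 1/g reads E(v(-f)) = E(-sigma(v)); since E - 1 has order 1,
   E can be cancelled, and this becomes f = k o sigma o v.  The other condition
   (-f) o (-f) = z follows: g(-f) = 1/g gives g((-f) o (-f)) = g, and g can be
   cancelled as well.  Here sigma = z/(1+z) in part 1 and sigma = z in part 2;
   the second form of part 1 holds as z/(1+z) = s o s, where s = 2z/(2+z) is its
   own pseudo-inverse.  The matrix [g,f] is the conjugate of (g,f) by diag(n!), so
   the two notions of pseudo-involution agree. *)
Require Import Defs.
From mathcomp Require Import all_boot all_order all_algebra.
From mathcomp Require Import reals.
From mathcomp Require Import ring.

Set Implicit Arguments.
Unset Strict Implicit.
Unset Printing Implicit Defensive.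

Import GRing.Theory Num.Theory.

Local Open Scope ring_scope.

(** * Coefficients of power series, right composition as a ring morphism, cancellation *)

Section FpsComposition.
Variable R : fieldType.
Implicit Types a b c e f g h k q v s gamma : {fps R}.

Lemma fps_coefM0 a b : (a * b) 0%N = a 0%N * b 0%N.
Proof. by rewrite fps_coefM big_ord_recl big_ord0 addr0. Qed.

Lemma fps_coefV0 a : (a^-1) 0%N = (a 0%N)^-1.
Proof.
have [ua|/[dup] nua] := boolP (a \is a GRing.unit); last first.
  (* A non-unit is its own inverse by convention; its constant term is 0, which is also its own
     inverse in [R]. *)
  by rewrite fps_unitE negbK invr_out // => /eqP ->; rewrite invr0.
have a0 : a 0%N != 0 by rewrite -fps_unitE.
apply: (mulfI a0); rewrite divff // -[RHS]/((1 : {fps R}) 0%N).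
by rewrite -(divrr ua) fps_coefM0.
Qed.

Lemma fps_natr0 n : (n%:R : {fps R}) 0%N = n%:R.
Proof. by elim: n => // n IH; rewrite !mulrS fps_coefD IH. Qed.

Lemma fpsX0 : (fpsX : {fps R}) 0%N = 0. Proof. by []. Qed.

Lemma fps_coefMX a n : (fpsX * a) n.+1 = a n.
Proof.
rewrite fps_coefM big_ord_recl /= mul0r add0r big_ord_recl /= mul1r subSS subn0.
by rewrite big1 ?addr0 // => i _; rewrite mul0r.
Qed.

Lemma fps_orderXM a : a 0%N != 0 -> fps_order 1 (fpsX * a).
Proof. by move=> a0; split=> [[]//|]; rewrite ?fps_coefM0 ?mul0r ?fps_coefMX. Qed.

Lemma fps_compD a b c : (a + b) \oS c = (a \oS c) + (b \oS c).
Proof.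
apply: fpsP => n; rewrite fps_coefD -big_split /=.
by apply: eq_bigr => i _; rewrite mulrDl.
Qed.

Lemma fps_compN a c : (- a) \oS c = - (a \oS c).
Proof.
apply: fpsP => n; rewrite fps_coefN -sumrN /=.
by apply: eq_bigr => i _; rewrite mulNr.
Qed.

Lemma fps_compB a b c : (a - b) \oS c = (a \oS c) - (b \oS c).
Proof. by rewrite fps_compD fps_compN. Qed.

Lemma fps_comp_nat n c : n%:R \oS c = n%:R.
Proof.
elim: n => [|n IH]; last by rewrite !mulrS fps_compD IH fps_comp1.
by apply: fpsP => n /=; rewrite big1 // => i _; rewrite mul0r.
Qed.

Lemma fps_compV a c : c 0%N = 0 -> a 0%N != 0 -> a^-1 \oS c = (a \oS c)^-1.
Proof.
move=> c0 a0; have ua : a \is a GRing.unit by rewrite fps_unitE.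
have uac : a \oS c \is a GRing.unit by rewrite fps_unitE fps_comp0.
by apply: (mulrI uac); rewrite -fps_compM // !divrr // fps_comp1.
Qed.

Lemma fps_NXcomp a : a 0%N = 0 -> (- fpsX) \oS a = - a.
Proof. by move=> a0; rewrite fps_compN fps_Xcomp. Qed.

Lemma fps_order1_comp a b : fps_order 1 a -> fps_order 1 b ->
  fps_order 1 (a \oS b).
Proof.
move=> oa ob; have a0 := oa.1 0%N isT; split=> [[]//|]; first by rewrite fps_comp0.
rewrite /= !big_ord_recl big_ord0 a0 mul0r add0r addr0 expr1.
by rewrite mulf_neq0 //; [apply: oa.2 | apply: ob.2].
Qed.

Lemma fps_coefXn m n : (fpsX ^+ m : {fps R}) n = (n == m)%:R.
Proof.
elim: m n => [|m IH] [|n] //; first by rewrite exprS fps_coefM0 mul0r.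
by rewrite exprS fps_coefMX IH.
Qed.

(** Each power of -z is a monomial up to sign, so only the diagonal term of the composition sum
    survives. *)
Lemma fps_coef_compNX a n : (a \oS (- fpsX)) n = (-1) ^+ n * a n.
Proof.
have NXn m : ((- fpsX : {fps R}) ^+ m) n = (-1) ^+ m * (n == m)%:R.
  rewrite (exprNn fpsX) -signr_odd -[in RHS]signr_odd -fps_coefXn.
  by case: odd; rewrite ?expr1 ?mulN1r ?expr0 ?mul1r.
rewrite /= big_ord_recr /= NXn eqxx mulr1 mulrC big1 ?add0r // => i _.
by rewrite NXn gtn_eqF ?mulr0.
Qed.

Lemma fps_at1_comp c a b : a 0%N = 1 -> b 0%N = 0 ->
  fps_at1 c a \oS b = fps_at1 c (a \oS b).
Proof.
move=> a1 b0; rewrite /fps_at1 -fps_compA //; last first.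
  by rewrite fps_coefD a1 fps_coefN fps_coef1 subrr.
by rewrite fps_compB fps_comp1.
Qed.

Lemma fps_at1_0 c a : fps_at1 c a 0%N = c 0%N.
Proof. exact: fps_comp0. Qed.

(** Subtracting 1 from both sides turns [e] into the order-1 series [e - 1], whose compositional
    inverse then cancels it. *)
Lemma fps_comp_inj e a b : fps_order 1 (e - 1) -> a 0%N = 0 -> b 0%N = 0 ->
  e \oS a = e \oS b -> a = b.
Proof.
move=> oe a0 b0 eab; have [ce _] := fps_cinvP oe; have e0 := oe.1 0%N isT.
rewrite -(fps_Xcomp a0) -(fps_Xcomp b0) -ce.
rewrite -(fps_compA _ e0 a0) -(fps_compA _ e0 b0).
by rewrite !fps_compB eab !fps_comp1.
Qed.

(** * Compositional inverses and pseudo-inverses *)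

Lemma fps_cinv_right f h : fps_order 1 f -> h 0%N = 0 -> f \oS h = fpsX ->
  fps_cinv f = h.
Proof.
move=> of1 h0 fh; have [cf _] := fps_cinvP of1.
by rewrite -(fps_compX (fps_cinv f)) -fh fps_compA ?cf ?fps_Xcomp //; apply: of1.1.
Qed.

Lemma fps_cinv0 f : fps_order 1 f -> fps_cinv f 0%N = 0.
Proof. by move=> of1; have [cf _] := fps_cinvP of1; rewrite -(fps_comp0 _ f) cf. Qed.

Lemma fps_hatE k : fps_order 1 k -> fps_hat k = - (fps_cinv k \oS (- fpsX)).
Proof. by move=> ok; rewrite /fps_hat fps_NXcomp ?fps_compN ?fps_cinv0. Qed.

Lemma fps_hat0 k : fps_order 1 k -> fps_hat k 0%N = 0.
Proof. by move=> ok; rewrite fps_hatE // fps_coefN fps_comp0 fps_cinv0 ?oppr0. Qed.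

(** The sign inside the pseudo-inverse absorbs that of [- f]; this is how g(-f) becomes an
    expression in f itself. *)
Lemma fps_hat_compN k f : fps_order 1 k -> f 0%N = 0 ->
  fps_hat k \oS (- f) = - (fps_cinv k \oS f).
Proof.
move=> ok f0; have NX0 : (- fpsX : {fps R}) 0%N = 0 by rewrite fps_coefN oppr0.
have Nf0 : (- f) 0%N = 0 by rewrite fps_coefN f0 oppr0.
by rewrite fps_hatE // fps_compN -(fps_compA _ NX0 Nf0) fps_NXcomp // opprK.
Qed.

(** This identifies a pseudo-inverse from a single one-sided equation, without computing any
    inverse. *)
Lemma fps_hat_uniq k v : fps_order 1 k -> v 0%N = 0 -> k \oS (- v) = - fpsX ->
  fps_hat k = v.
Proof.
move=> ok v0 kv; have Nv0 : (- v) 0%N = 0 by rewrite fps_coefN v0 oppr0.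
have NX0 : (- fpsX : {fps R}) 0%N = 0 by rewrite fps_coefN oppr0.
(* Substituting -z into k(-v) = -z gives z on the right, so the right inverse of [k] can be read
   off. *)
have cE : fps_cinv k = (- v) \oS (- fpsX).
  apply: fps_cinv_right => //; first by rewrite fps_comp0.
  by rewrite fps_compA // kv fps_NXcomp ?opprK.
by rewrite fps_hatE // cE -fps_compA // fps_NXcomp // opprK fps_compX opprK.
Qed.

(** As for inverses, the order is reversed; the two signs that meet in the middle cancel. *)
Lemma fps_hat_comp a b : fps_order 1 a -> fps_order 1 b ->
  fps_hat (a \oS b) = fps_hat b \oS fps_hat a.
Proof.
move=> oa ob; have a0 := oa.1 0%N isT; have b0 := ob.1 0%N isT.
have ca0 := fps_cinv0 oa; have cb0 := fps_cinv0 ob.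
have oab := fps_order1_comp oa ob.
have NX0 : (- fpsX : {fps R}) 0%N = 0 by rewrite fps_coefN oppr0.
have cE : fps_cinv (a \oS b) = fps_cinv b \oS fps_cinv a.
  apply: fps_cinv_right => //; first by rewrite fps_comp0.
  rewrite fps_compA // -(fps_compA a) // (fps_cinvP ob).2 fps_compX.
  exact: (fps_cinvP oa).2.
rewrite [fps_hat a]fps_hatE // fps_hat_compN ?fps_comp0 // fps_hatE // cE.
by rewrite fps_compA.
Qed.

(** The pseudo-inverse of [a \oS s] begins with [s] again, so two copies of [s] meet. With s =
    2z/(2+z), this converts one form of part 1 into the other. *)
Lemma fps_comp_hat_sqr a s : fps_order 1 a -> fps_order 1 s -> fps_hat s = s ->
  (a \oS s) \oS fps_hat (a \oS s) = a \oS (s \oS s) \oS fps_hat a.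
Proof.
move=> oa os hs; have s0 := os.1 0%N isT; have h0 := fps_hat0 oa.
have ss0 : (s \oS s) 0%N = 0 by rewrite fps_comp0.
have sh0 : (s \oS fps_hat a) 0%N = 0 by rewrite fps_comp0.
rewrite (fps_hat_comp oa os) hs -(fps_compA a s0 sh0) -(fps_compA a ss0 h0).
by rewrite (fps_compA s s0 h0).
Qed.

(** * Products of Riordan arrays and pseudo-involutions *)

Lemma ltmx_mul_riordan g f g' f' n m : f 0%N = 0 ->
  ltmx_mul (riordan g f) (riordan g' f') n m =
  riordan (g * (g' \oS f)) (f' \oS f) n m.
Proof.
move=> f0; rewrite /riordan -fps_compXn // -mulrA -fps_compM //.
(* Column m of the second array is the series [a]; the claim is that the array (g,f) sends [a] to g
   times a(f), which is an exchange of sums. *)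
set a := g' * f' ^+ m.
transitivity (\sum_(j < n.+1) \sum_(i < n.+1) g i * ((f ^+ j) (n - i)%N * a j)).
  by apply: eq_bigr => j _; rewrite fps_coefM mulr_suml; apply: eq_bigr => i _;
    rewrite mulrA.
rewrite fps_coefM exchange_big; apply: eq_bigr => i _.
rewrite (fps_comp_wide a f0 (leq_subr i n)) mulr_sumr; apply: eq_bigr => j _.
by rewrite [a j * _]mulrC.
Qed.

Lemma riordan1X : riordan 1 fpsX =2 @ltmx_id R.
Proof. by move=> n j; rewrite /riordan mul1r fps_coefXn. Qed.

(** Column 0 is g and column 1 is gf, from which the unit g can be cancelled. *)
Lemma riordan_inj g f g' f' : g 0%N != 0 ->
  riordan g f =2 riordan g' f' -> g = g' /\ f = f'.
Proof.
move=> g0 E; have gg' : g = g'.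
  by apply: fpsP => n; have := E n 0%N; rewrite /riordan !expr0 !mulr1.
split=> //; have ug : g \is a GRing.unit by rewrite fps_unitE.
apply: (mulrI ug); apply: fpsP => n; have := E n 1%N.
by rewrite /riordan !expr1 -gg'.
Qed.

Lemma pseudo_involutionE g f : f 0%N = 0 -> g 0%N != 0 ->
  pseudo_involution g f <->
  g * (g \oS (- f)) = 1 /\ (- f) \oS (- f) = fpsX.
Proof.
move=> f0 g0; have Nf0 : (- f) 0%N = 0 by rewrite fps_coefN f0 oppr0.
split=> [E|[gg ff] n k]; last first.
  by rewrite ltmx_mul_riordan // gg ff riordan1X.
apply: riordan_inj; first by rewrite fps_coefM0 fps_comp0 mulf_neq0.
by move=> n k; rewrite -ltmx_mul_riordan // E riordan1X.
Qed.

Lemma pseudo_involution_inv g f : f 0%N = 0 -> g 0%N != 0 ->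
  fps_order 1 (g - 1) -> pseudo_involution g f <-> g * (g \oS (- f)) = 1.
Proof.
move=> f0 g0 og; rewrite pseudo_involutionE //; split=> [[]//|gg].
have Nf0 : (- f) 0%N = 0 by rewrite fps_coefN f0 oppr0.
split=> //; apply: (fps_comp_inj og); rewrite ?fps_comp0 //.
have ug' : g \oS (- f) \is a GRing.unit by rewrite fps_unitE fps_comp0.
(* Multiplied by g(-f), the goal becomes [gg] composed with [- f] on one side and [gg] itself on the
   other. *)
apply: (mulrI ug'); rewrite fps_compX [RHS]mulrC gg fps_compA //.
by rewrite -fps_compM // gg fps_comp1.
Qed.

Lemma exp_riordanE g f n m :
  exp_riordan g f n m = n`!%:R / m`!%:R * riordan g f n m.
Proof. by []. Qed.

(** * The criterion common to both parts *)

Lemma fps_order1_quotient gamma a : gamma 0%N != 0 ->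
  fps_order 1 (fpsX / fps_at1 gamma a).
Proof. by move=> c0; apply: fps_orderXM; rewrite fps_coefV0 fps_at1_0 invr_eq0. Qed.

(** Substituting [- v] into the quotient gives -v/gamma(e(v)), and the equation for [v] makes this
    -z. *)
Lemma fps_hat_solution gamma e v : gamma 0%N != 0 -> e 0%N = 1 ->
  v = fpsX * fps_at1 gamma (e \oS v) ->
  fps_hat (fpsX / fps_at1 gamma (e \oS (- fpsX))) = v.
Proof.
move=> c0 e1 vE; have v0 : v 0%N = 0 by rewrite vE fps_coefM0 mul0r.
have Nv0 : (- v) 0%N = 0 by rewrite fps_coefN v0 oppr0.
have NX0 : (- fpsX : {fps R}) 0%N = 0 by rewrite fps_coefN oppr0.
apply: fps_hat_uniq => //; first exact: fps_order1_quotient.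
rewrite fps_compM // fps_compV ?fps_at1_0 // fps_Xcomp //.
rewrite fps_at1_comp ?fps_comp0 // -fps_compA // fps_NXcomp // opprK.
by rewrite {1}vE -mulNr mulrK // fps_unitE fps_at1_0.
Qed.

(** Here [e] and [s] are the E and sigma of the overview; both parts of the theorem are
    instances. *)
Lemma pseudo_involution_hat gamma e v s f : gamma 0%N != 0 -> f 0%N = 0 ->
  e 0%N = 1 -> fps_order 1 (e - 1) -> s 0%N = 0 -> e * (e \oS (- s)) = 1 ->
  v = fpsX * fps_at1 gamma (e \oS v) ->
  let k : {fps R} := fpsX / fps_at1 gamma (e \oS (- fpsX)) in
  pseudo_involution (e \oS v) f <-> f = k \oS s \oS fps_hat k.
Proof.
move=> c0 f0 e1 oe s0 es vE k; have hk : fps_hat k = v by exact: fps_hat_solution.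
have ok : fps_order 1 k by exact: fps_order1_quotient.
(* From here on, [k] enters only through its order and [hk]. *)
clearbody k.
have k0 := ok.1 0%N isT.
have ov : fps_order 1 v by rewrite vE; apply: fps_orderXM; rewrite fps_at1_0.
have v0 := ov.1 0%N isT.
have Nf0 : (- f) 0%N = 0 by rewrite fps_coefN f0 oppr0.
have Ns0 : (- s) 0%N = 0 by rewrite fps_coefN s0 oppr0.
have og : fps_order 1 ((e \oS v) - 1).
  by rewrite -(fps_comp1 v) -fps_compB; apply: fps_order1_comp.
have g0 : (e \oS v) 0%N != 0 by rewrite fps_comp0 e1 oner_eq0.
have ug : e \oS v \is a GRing.unit by rewrite fps_unitE.
have gs : (e \oS v) * (e \oS ((- s) \oS v)) = 1.
  by rewrite (fps_compA e Ns0 v0) -fps_compM // es fps_comp1.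
have ck0 := fps_cinv0 ok.
have gf : (e \oS v) \oS (- f) = e \oS (- (fps_cinv k \oS f)).
  by rewrite -(fps_compA e v0 Nf0) -hk fps_hat_compN.
(* The right-hand 1 is rewritten by [gs] as a multiple of g, so that the unit g cancels and two
   values of [e] remain to be compared. *)
rewrite pseudo_involution_inv // gf hk -(fps_compA k s0 v0) -gs fps_compN.
have sv0 : (s \oS v) 0%N = 0 by rewrite fps_comp0.
split=> [/(mulrI ug) E|fE]; last first.
  have -> : fps_cinv k \oS f = s \oS v; last by [].
  by rewrite fE (fps_compA _ k0 sv0) (fps_cinvP ok).1 fps_Xcomp.
have {}E : fps_cinv k \oS f = s \oS v.
  by apply: oppr_inj; apply: fps_comp_inj oe _ _ E;
    rewrite fps_coefN fps_comp0 ?ck0 ?s0 oppr0.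
by rewrite -E (fps_compA k ck0 f0) (fps_cinvP ok).2 fps_Xcomp.
Qed.

(** * The case g = 1 + z gamma(g) *)

Lemma pseudo_involution_1D gamma f g : gamma 0%N != 0 -> f 0%N = 0 ->
  g = 1 + fpsX * fps_at1 gamma g ->
  let q : {fps R} := fpsX / fps_at1 gamma (1 - fpsX) in
  pseudo_involution g f <-> f = q \oS (fpsX / (1 + fpsX)) \oS fps_hat q.
Proof.
move=> c0 f0 gE q; pose e : {fps R} := 1 + fpsX; pose v : {fps R} := g - 1.
have NX0 : (- fpsX : {fps R}) 0%N = 0 by rewrite fps_coefN oppr0.
have eE b : b 0%N = 0 -> e \oS b = 1 + b.
  by move=> b0; rewrite fps_compD fps_comp1 fps_Xcomp.
have vX : v = fpsX * fps_at1 gamma g by rewrite /v {1}gE addrAC subrr add0r.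
have v0 : v 0%N = 0 by rewrite vX fps_coefM0 mul0r.
have ev : e \oS v = g by rewrite eE // /v addrC subrK.
have e0 : e 0%N = 1 by rewrite fps_coefD fpsX0 addr0.
have ue : e \is a GRing.unit by rewrite fps_unitE e0 oner_eq0.
have oe : fps_order 1 (e - 1).
  by rewrite /e addrAC subrr add0r -[fpsX]mulr1; apply: fps_orderXM; rewrite oner_eq0.
have t0 : (fpsX / (1 + fpsX) : {fps R}) 0%N = 0 by rewrite fps_coefM0 mul0r.
(* This is 1 - z/(1+z) = 1/(1+z), the condition on sigma. *)
have es : e * (e \oS (- (fpsX / (1 + fpsX)))) = 1.
  rewrite eE ?fps_coefN ?t0 ?oppr0 // mulrBr mulr1 mulrCA divrr // mulr1.
  by rewrite /e addrK.
have vE : v = fpsX * fps_at1 gamma (e \oS v) by rewrite ev.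
have := pseudo_involution_hat c0 f0 e0 oe t0 es vE.
by rewrite ev (eE _ NX0).
Qed.

End FpsComposition.

(** * Exponential arrays and the exponential series in characteristic 0 *)

Section Characteristic0.
Variable R : numFieldType.
Implicit Types b f g h q gamma : {fps R}.

Lemma factr_neq0 n : n`!%:R != 0 :> R.
Proof. by rewrite pnatr_eq0 -lt0n fact_gt0. Qed.

(** Conjugation by diag(n!) multiplies entry (n,m) of the square by the nonzero factor n!/m!, and it
    fixes the identity matrix. *)
Lemma exp_pseudo_involutionE g f :
  exp_pseudo_involution g f <-> pseudo_involution g f.
Proof.
have E n m : ltmx_mul (exp_riordan g (- f)) (exp_riordan g (- f)) n m =
    n`!%:R / m`!%:R * ltmx_mul (riordan g (- f)) (riordan g (- f)) n m.
  rewrite mulr_sumr; apply: eq_bigr => j _; rewrite !exp_riordanE.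
  by field; rewrite !factr_neq0.
have idE n m : ltmx_id R n m = n`!%:R / m`!%:R * ltmx_id R n m.
  rewrite /ltmx_id; have [->|] := eqVneq; last by rewrite mulr0.
  by rewrite divff ?mul1r ?factr_neq0.
have c0 n m : n`!%:R / m`!%:R != 0 :> R by rewrite mulf_neq0 ?invr_eq0 ?factr_neq0.
split=> H n m; last by rewrite E H -idE.
by apply: (mulfI (c0 n m)); rewrite -E -idE H.
Qed.

(** Up to the factor 1/n!, coefficient n of the product is the binomial expansion of (-1 + 1)^n. *)
Lemma fps_expN : fps_exp * (fps_exp \oS (- fpsX)) = 1 :> {fps R}.
Proof.
apply: fpsP => n; rewrite fps_coefM fps_coef1.
transitivity ((n`!%:R)^-1 * (-1 + 1) ^+ n : R); last first.
  by rewrite addNr expr0n; case: n => [|n]; rewrite ?mulr0 // fact0 invr1 mulr1.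
rewrite exprDn mulr_sumr; apply: eq_bigr => i _.
have le_in : (i <= n)%N by rewrite -ltnS.
rewrite fps_coef_compNX expr1n mulr1 /= -(bin_fact le_in) !natrM -mulr_natr.
have C0 : 'C(n, i)%:R != 0 :> R by rewrite pnatr_eq0 -lt0n bin_gt0.
by field; rewrite C0 !factr_neq0.
Qed.

(** * The series 2z/(2+z) and the two closed forms of [h] *)

Let two_neq0 : (2 : {fps R}) 0%N != 0.
Proof. by rewrite fps_natr0 pnatr_eq0. Qed.

Let den0 b : b 0%N = 0 -> (2 + b : {fps R}) 0%N != 0.
Proof. by move=> b0; rewrite fps_coefD b0 addr0. Qed.

Lemma fps_unit2D b : b 0%N = 0 -> (2 + b : {fps R}) \is a GRing.unit.
Proof. by move=> b0; rewrite fps_unitE den0. Qed.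

(** The maps z/(1+tz) compose by adding t; this one has t = 1/2, hence the square z/(1+z). Both
    inversion and conjugation by -z replace t by -t, hence the invariance under pseudo-inversion. *)
Definition fps_mobius : {fps R} := 2 * fpsX / (2 + fpsX).
Local Notation s := fps_mobius.

Lemma fps_comp_mobius b : b 0%N = 0 -> s \oS b = 2 * b / (2 + b).
Proof.
move=> b0; rewrite /fps_mobius !fps_compM // fps_compV ?den0 //.
by rewrite (fps_compD _ fpsX) !(fps_comp_nat 2) fps_Xcomp.
Qed.

Lemma fps_mobius_order1 : fps_order 1 s.
Proof.
rewrite /fps_mobius [2 * _]mulrC -mulrA; apply: fps_orderXM.
by rewrite fps_coefM0 fps_coefV0 mulf_neq0 ?invr_eq0 ?den0.
Qed.

Lemma fps_hat_mobius : fps_hat s = s.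
Proof.
have s0 := fps_mobius_order1.1 0%N isT.
have Ns0 : (- s) 0%N = 0 by rewrite fps_coefN s0 oppr0.
apply: fps_hat_uniq => //; first exact: fps_mobius_order1.
rewrite fps_comp_mobius //; apply: (mulIr (fps_unit2D Ns0)).
rewrite divrK ?fps_unit2D //; apply: (mulIr (fps_unit2D (fpsX0 R))).
have sE : s * (2 + fpsX) = 2 * fpsX by rewrite divrK ?fps_unit2D.
(* [ring] knows nothing of the division in [s], so the product [s * (2 + fpsX)] is isolated and then
   replaced using [sE]. *)
transitivity (- (2 * (s * (2 + fpsX)))); first by ring.
transitivity (- fpsX * (2 * (2 + fpsX) - s * (2 + fpsX))); last by ring.
by rewrite sE; ring.
Qed.

Lemma fps_mobius_sqr : s \oS s = fpsX / (1 + fpsX).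
Proof.
have s0 := fps_mobius_order1.1 0%N isT.
have u1 : (1 + fpsX : {fps R}) \is a GRing.unit.
  by rewrite fps_unitE fps_coefD fpsX0 addr0 oner_eq0.
rewrite fps_comp_mobius //; apply: (mulIr (fps_unit2D s0)).
rewrite divrK ?fps_unit2D //; apply: (mulIr u1).
rewrite [RHS]mulrAC divrK //; apply: (mulIr (fps_unit2D (fpsX0 R))).
have sE : s * (2 + fpsX) = 2 * fpsX by rewrite divrK ?fps_unit2D.
transitivity (2 * (s * (2 + fpsX)) * (1 + fpsX)); first by ring.
transitivity (fpsX * (2 * (2 + fpsX) + s * (2 + fpsX))); last by ring.
by rewrite sE; ring.
Qed.

Lemma fps_1sub_mobius : 1 - s = (2 - fpsX) / (2 + fpsX).
Proof.
have u2 := fps_unit2D (fpsX0 R).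
have sE : s * (2 + fpsX) = 2 * fpsX by rewrite divrK.
apply: (mulIr u2); rewrite divrK // mulrBl sE mul1r.
by ring.
Qed.

(** The argument of gamma becomes 1 - s = (2-z)/(2+z), and the denominator of [s] joins that of the
    quotient. *)
Lemma fps_quotient_mobius gamma : gamma 0%N != 0 ->
  fpsX / fps_at1 gamma (1 - fpsX) \oS s =
  2 * fpsX / ((2 + fpsX) * fps_at1 gamma ((2 - fpsX) / (2 + fpsX))).
Proof.
move=> c0; have s0 := fps_mobius_order1.1 0%N isT.
have u2 := fps_unit2D (fpsX0 R).
rewrite fps_compM // fps_compV ?fps_at1_0 // fps_Xcomp //.
rewrite fps_at1_comp ?fps_coefD ?fps_coefN ?fpsX0 ?subr0 //.
rewrite fps_compB fps_comp1 fps_Xcomp // fps_1sub_mobius.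
set w := fps_at1 _ _; have uw : w \is a GRing.unit by rewrite fps_unitE fps_at1_0.
by rewrite /fps_mobius -mulrA -invrM // [w * _]mulrC.
Qed.

(** With b = z/2, one has 2 + z = 2(1 + b) and 2 - z = 2(1 - b): the factors 2 cancel inside gamma,
    and once more in the outer fraction. *)
Lemma fps_quotient_conj_half gamma : gamma 0%N != 0 ->
  (2 * fpsX)
    \oS (fpsX / ((1 + fpsX) * fps_at1 gamma ((1 - fpsX) / (1 + fpsX))))
    \oS (fpsX / 2) =
  2 * fpsX / ((2 + fpsX) * fps_at1 gamma ((2 - fpsX) / (2 + fpsX))).
Proof.
move=> c0; pose b : {fps R} := fpsX / 2.
have u2 := fps_unit2D (fpsX0 R).
have two_unit : (2 : {fps R}) \is a GRing.unit by rewrite fps_unitE.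
have b0 : b 0%N = 0 by rewrite fps_coefM0 mul0r.
have bE : fpsX = 2 * b by rewrite mulrC divrK.
rewrite -/b; clearbody b.
have ub : (1 + b) \is a GRing.unit by rewrite fps_unitE fps_coefD b0 addr0 oner_eq0.
have dE : 2 + fpsX = 2 * (1 + b) by rewrite bE mulrDr mulr1.
have nE : 2 - fpsX = 2 * (1 - b) by rewrite bE mulrBr mulr1.
have rE : (2 - fpsX) / (2 + fpsX) = (1 - b) / (1 + b).
  by rewrite dE nE invrM // [_^-1 * _]mulrC mulrACA divrr // mul1r.
have u1 : (1 + fpsX : {fps R}) \is a GRing.unit by rewrite fps_unitE fps_coefD addr0 oner_eq0.
have n1 : (1 + fpsX : {fps R}) 0%N != 0 by rewrite -fps_unitE.
pose r : {fps R} := (1 - fpsX) / (1 + fpsX).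
have r1 : r 0%N = 1.
  rewrite fps_coefM0 fps_coefV0 !fps_coefD fps_coefN fpsX0 oppr0 !addr0.
  by rewrite divff ?oner_eq0.
have rb : r \oS b = (1 - b) / (1 + b).
  rewrite (fps_compM _ _ b0) (fps_compV b0 n1) fps_compB fps_compD fps_comp1.
  by rewrite (fps_Xcomp b0).
rewrite -/r; clearbody r; pose d : {fps R} := (1 + fpsX) * fps_at1 gamma r.
have d0 : d 0%N != 0 by rewrite fps_coefM0 fps_at1_0 fps_coefD addr0 mul1r.
have db : d \oS b = (1 + b) * fps_at1 gamma ((1 - b) / (1 + b)).
  rewrite (fps_compM _ _ b0) (fps_at1_comp gamma r1 b0) rb fps_compD fps_comp1.
  by rewrite (fps_Xcomp b0).
rewrite -/d rE dE -[2 * (1 + b) * _]mulrA -db; clearbody d.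
have A0 : (fpsX / d) 0%N = 0 by rewrite fps_coefM0 mul0r.
have udb : d \oS b \is a GRing.unit by rewrite fps_unitE fps_comp0.
have -> : (2 * fpsX) \oS (fpsX / d) = 2 * (fpsX / d).
  by rewrite (fps_compM _ _ A0) (fps_comp_nat 2) (fps_Xcomp A0).
rewrite (fps_compM _ _ b0) (fps_comp_nat 2) (fps_compM _ _ b0) (fps_compV b0 d0).
rewrite (fps_Xcomp b0) invrM // [_^-1 * _]mulrC mulrACA divrr // mul1r mulrA.
by rewrite -bE.
Qed.

(** * The case g = exp(z gamma(g)) *)

Lemma pseudo_involution_exp gamma f g : gamma 0%N != 0 -> f 0%N = 0 ->
  g = fps_exp \oS (fpsX * fps_at1 gamma g) ->
  let h : {fps R} := fpsX / fps_at1 gamma (fps_exp \oS (- fpsX)) in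
  pseudo_involution g f <-> f = h \oS fps_hat h.
Proof.
move=> c0 f0 gE h; pose v : {fps R} := fpsX * fps_at1 gamma g.
have ev : fps_exp \oS v = g by rewrite [RHS]gE.
have e0 : (fps_exp : {fps R}) 0%N = 1 by rewrite /= fact0 invr1.
have oe : fps_order 1 (fps_exp - 1 : {fps R}).
  split=> [[]//|]; first by rewrite fps_coefD e0 fps_coefN subrr.
  by rewrite fps_coefD fps_coefN subr0 /= invr_eq0 factr_neq0.
have vE : v = fpsX * fps_at1 gamma (fps_exp \oS v) by rewrite ev.
(* Here sigma = z: its condition is [fps_expN], and composing with it changes nothing. *)
have := pseudo_involution_hat c0 f0 e0 oe (fpsX0 R) fps_expN vE.
by cbv zeta; rewrite ev fps_compX.
Qed.

End Characteristic0.

Theorem theorem3p3 (R : realType) (gamma f : {fps R})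
    (gamma1_neq0 : gamma 0%N != 0) (f_order1 : fps_order 1 f) :
  (forall g : {fps R}, g 0%N = 1 -> g = 1 + fpsX * fps_at1 gamma g ->
    let q := fpsX / fps_at1 gamma (1 - fpsX) in
    let h := q \oS (2 * fpsX / (2 + fpsX)) in
    ((pseudo_involution g f <->
        f = q \oS (fpsX / (1 + fpsX)) \oS fps_hat q) /\
     (exp_pseudo_involution g f <->
        f = q \oS (fpsX / (1 + fpsX)) \oS fps_hat q)) /\
    ((pseudo_involution g f <-> f = h \oS fps_hat h) /\
     (exp_pseudo_involution g f <-> f = h \oS fps_hat h)) /\
    h = 2 * fpsX /
        ((2 + fpsX) * fps_at1 gamma ((2 - fpsX) / (2 + fpsX))) /\
    h = (2 * fpsX)
        \oS (fpsX / ((1 + fpsX) * fps_at1 gamma ((1 - fpsX) / (1 + fpsX))))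
        \oS (fpsX / 2)) /\
  (forall g : {fps R}, g 0%N = 1 ->
    g = fps_exp \oS (fpsX * fps_at1 gamma g) ->
    let h := fpsX / fps_at1 gamma (fps_exp \oS (- fpsX)) in
    (pseudo_involution g f <-> f = h \oS fps_hat h) /\
    (exp_pseudo_involution g f <-> f = h \oS fps_hat h)).
Proof.
have f0 := f_order1.1 0%N isT.
split=> [g _ gE q h | g _ gE h]; last first.
  by rewrite exp_pseudo_involutionE; split; apply: pseudo_involution_exp.
have oq : fps_order 1 q by apply: fps_order1_quotient.
(* The right-hand sides of the two criteria of part 1 are the same series, so one equivalence
   settles both. *)
have hh : h \oS fps_hat h = q \oS (fpsX / (1 + fpsX)) \oS fps_hat q.
  rewrite -fps_mobius_sqr; apply: fps_comp_hat_sqr => //.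
    exact: fps_mobius_order1.
  exact: fps_hat_mobius.
have hE := fps_quotient_mobius gamma1_neq0.
have pq := pseudo_involution_1D gamma1_neq0 f0 gE.
rewrite hh exp_pseudo_involutionE; split; first by split.
split; first by split.
split; first exact: hE.
exact: etrans hE (esym (fps_quotient_conj_half gamma1_neq0)).
Qed.
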